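(* Let $n$ and $r$ be integers with $1\le r\le n$. Let $A_{11}$ and $X$ be $r\times r$ (complex Hermitian) positive definite matrices and let $A_{12}$ be an $r\times (n-r)$ complex matrix such that $X(A_{11}^2+A_{12}A_{12}^* )X=I_r$. Then the $n\times n$ Hermitian matrix below satisfies $$\lambda_r\begin{pmatrix} A_{11}+X & A_{12}\\ A_{12}^* & A_{12}^*A_{11}^{-1}A_{12}\end{pmatrix}\ge 2.$$
   Context: All matrices are complex, $M^*$ denotes the conjugate transpose of $M$, and $I_r$ is the $r\times r$ identity matrix. For a square matrix $M$ all of whose eigenvalues are real, $\lambda_j(M)$ denotes its $j$-th largest eigenvalue, counted with multiplicity. When $r=n$ the blocks involving $A_{12}$ are empty, so that the hypothesis reads $XA_{11}^2X=I_n$ and the matrix in the conclusion is $A_{11}+X$. *)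

(* Defs.v *)
From mathcomp Require Import all_boot all_order all_algebra.
From mathcomp Require Import complex.

Set Implicit Arguments.
Unset Strict Implicit.
Unset Printing Implicit Defensive.

Import Order.TTheory GRing.Theory Num.Theory.

Local Open Scope ring_scope.
Local Open Scope sesquilinear_scope.

(* The order on a numClosedFieldType is partial: [0 < z] says that z is real
   and positive. *)
Definition posdefmx (C : numClosedFieldType) (n : nat) (A : 'M[C]_n) : Prop :=
  A \is hermsymmx /\
  forall u : 'cV[C]_n, u != 0 -> 0 < (u ^t* *m A *m u) 0 0.

(* The roots of the characteristic polynomial, repeated according to their
   algebraic multiplicity. *)
Definition eigenvals (C : numClosedFieldType) (n : nat) (M : 'M[C]_n) : seq C :=
  sval (closed_field_poly_normal (char_poly M)).

(* The j-th largest eigenvalue, with j counted from 1. Meaningful when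
   1 <= j <= n and all the eigenvalues of M are real: the order of C is total
   on them, so they are sorted in nonincreasing order. *)
Definition eigval (C : numClosedFieldType) (n : nat) (j : nat) (M : 'M[C]_n) :
    C :=
  nth 0 (sort >=%R (eigenvals M)) j.-1.

(* Main.v *)
(* Write A = A11, B = A12, and let M be the block matrix. Let G be the positive
   definite solution of G A G = X (the geometric mean of A^-1 and X), and let V
   be the n x r matrix with blocks 1 + G and B^* A^-1. With Y = X^-1 the
   hypothesis reads B B^* = Y^2 - A^2, and completing squares gives
     V^*V = 4 A^-1 + D,
     V^*MV = 2 V^*V + 2 D + T1^* A^-1 T1 + T2^* X T2,
   where D = S1^* S1 + 2 S2^* G^-1 S2 with S1 = Y A^-1 - G, S2 = A^-1 - G, and
   T1 = A G + Y^2 A^-1 - 2, T2 = 1 + G - 2 Y G. Hence V is injective and M >= 2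
   on the r-dimensional column space of V, so Courant-Fischer applies. *)
Require Import Defs.
From mathcomp Require Import all_boot all_order all_algebra.
From mathcomp Require Import reals complex.
From mathcomp Require Import ring.

Set Implicit Arguments.
Unset Strict Implicit.
Unset Printing Implicit Defensive.

Import Order.TTheory GRing.Theory Num.Theory.

Local Open Scope ring_scope.
Local Open Scope sesquilinear_scope.

(** * Conjugate transposes and the quadratic forms they define *)

Section Adjoint.
Variable C : numClosedFieldType.

Lemma adjmxM m n p (A : 'M[C]_(m, n)) (B : 'M[C]_(n, p)) :
  (A *m B) ^t* = B ^t* *m A ^t*.
Proof. by rewrite trmx_mul map_mxM. Qed.

Lemma adjmxD m n (A B : 'M[C]_(m, n)) : (A + B) ^t* = A ^t* + B ^t*.
Proof. by rewrite linearD map_mxD. Qed.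

Lemma adjmxN m n (A : 'M[C]_(m, n)) : (- A) ^t* = - A ^t*.
Proof. by rewrite linearN map_mxN. Qed.

Lemma adjmx1 n : (1%:M : 'M[C]_n) ^t* = 1%:M.
Proof. by rewrite trmx1 map_mx1. Qed.

Lemma adjmxV n (A : 'M[C]_n) : (invmx A) ^t* = invmx (A ^t*).
Proof. by rewrite trmx_inv map_invmx. Qed.

Lemma hermsymmxP n (A : 'M[C]_n) : reflect (A ^t* = A) (A \is hermsymmx).
Proof.
apply: (iffP (is_hermitianmxP _ _ _)); rewrite expr0 scale1r; exact: esym.
Qed.

Lemma adjmx_diag_sum m (w : 'cV[C]_m) (d : 'rV[C]_m) :
  (w ^t* *m diag_mx d *m w) 0 0 = \sum_i d 0 i * `|w i 0| ^+ 2.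
Proof.
rewrite mxE; apply: eq_bigr => i _; rewrite mul_mx_diag !mxE normCK.
ring.
Qed.

Lemma adjmx_self_sum m (w : 'cV[C]_m) :
  (w ^t* *m w) 0 0 = \sum_i `|w i 0| ^+ 2.
Proof. by rewrite mxE; apply: eq_bigr => i _; rewrite !mxE mulrC normCK. Qed.

Lemma adjmx_self_gt0 m (w : 'cV[C]_m) : w != 0 -> 0 < (w ^t* *m w) 0 0.
Proof.
move=> /cV0Pn[i wi0]; rewrite adjmx_self_sum (bigD1 i) //=.
rewrite ltr_pwDl ?exprn_gt0 ?normr_gt0 //.
by apply: sumr_ge0 => j _; rewrite exprn_ge0.
Qed.
End Adjoint.

(** * Positive definite matrices, square roots and the equation G A G = X *)

Section PosDef.
Variables (C : numClosedFieldType) (n : nat).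
Implicit Types A X : 'M[C]_n.

Lemma posdefmx_adj A : posdefmx A -> A ^t* = A.
Proof. by case=> /hermsymmxP. Qed.

Lemma posdefmx_unit A : posdefmx A -> A \in unitmx.
Proof.
(* Passing to the transpose turns a row vector of the kernel into a column [v^T] killed by [A], on
   which the form vanishes. *)
case=> _ Apos; rewrite -unitmx_tr -row_free_unit; apply: inj_row_free => v vA0.
apply/eqP; apply: contraT => v0; have := Apos v^T.
rewrite trmx_eq0 => /(_ v0); rewrite -mulmxA.
by rewrite -[A *m _]trmxK trmx_mul trmxK vA0 trmx0 mulmx0 mxE ltxx.
Qed.

(** Meant for the squares left over after completion: there [N] may be singular, so only
    nonnegativity can be claimed. *)
Lemma posdefmx_ge0 A m (N : 'M[C]_(n, m)) (u : 'cV[C]_m) :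
  posdefmx A -> 0 <= (u ^t* *m (N ^t* *m A *m N) *m u) 0 0.
Proof.
case=> _ Apos.
have -> : u ^t* *m (N ^t* *m A *m N) *m u = (N *m u) ^t* *m A *m (N *m u).
  by rewrite adjmxM !mulmxA.
by have [-> | /Apos/ltW//] := eqVneq (N *m u) 0; rewrite mulmx0 mxE.
Qed.

Lemma posdefmx_congr A N : N \in unitmx -> posdefmx A ->
  posdefmx (N ^t* *m A *m N).
Proof.
move=> uN pA; split.
  apply/hermsymmxP; rewrite !adjmxM trmxCK (posdefmx_adj pA).
  by rewrite mulmxA.
move=> u u0.
have -> : u ^t* *m (N ^t* *m A *m N) *m u = (N *m u) ^t* *m A *m (N *m u).
  by rewrite adjmxM !mulmxA.
apply: pA.2; apply: contra_neq u0 => Nu0.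
by rewrite -(mulKmx uN u) Nu0 mulmx0.
Qed.

Lemma posdefmx_inv A : posdefmx A -> posdefmx (invmx A).
Proof.
move=> pA; have uA := posdefmx_unit pA.
have uV : invmx A \in unitmx by rewrite unitmx_inv.
have := posdefmx_congr uV pA.
by rewrite adjmxV (posdefmx_adj pA) mulVmx // mul1mx.
Qed.

Lemma posdefmx1 : posdefmx (1%:M : 'M[C]_n).
Proof.
split; first by apply/hermsymmxP; rewrite adjmx1.
by move=> u u0; rewrite mulmx1 adjmx_self_gt0.
Qed.

Lemma posdefmx_diag (d : 'rV[C]_n) :
  (forall i, 0 < d 0 i) <-> posdefmx (diag_mx d).
Proof.
split=> [d0 | [_ pd] i]; last first.
  have /pd : (delta_mx i 0 : 'cV[C]_n) != 0.
    by apply/cV0Pn; exists i; rewrite mxE !eqxx oner_eq0.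
  rewrite adjmx_diag_sum (bigD1 i) //= big1 => [|j ji].
    by rewrite !mxE !eqxx normr1 expr1n mulr1 addr0.
  by rewrite mxE (negPf ji) normr0 expr0n mulr0.
split=> [|u /cV0Pn[i ui0]].
  apply/hermsymmxP; rewrite tr_diag_mx map_diag_mx; congr diag_mx.
  by apply/rowP => i; rewrite mxE; apply/CrealP/gtr0_real.
rewrite adjmx_diag_sum (bigD1 i) //= ltr_pwDl //.
  by rewrite mulr_gt0 ?exprn_gt0 ?normr_gt0.
by apply: sumr_ge0 => j _; rewrite mulr_ge0 ?exprn_ge0 // ltW.
Qed.

(** Unitary diagonalization: square roots are taken of the eigenvalues, which are positive because
    the diagonal matrix is congruent to [A]. *)
Lemma posdefmx_sqrt A : posdefmx A -> exists2 S, posdefmx S & S *m S = A.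
Proof.
move=> pA; have := pA.1 => /hermitian_normalmx/orthomx_spectralP.
set P := spectralmx A; set d := spectral_diag A => AE.
have uP : P \in unitmx := spectral_unit A.
have PE : invmx P = P ^t* := invmx_unitary (spectral_unitarymx A).
have d0 i : 0 < d 0 i.
  apply/posdefmx_diag: i.
  have uV : invmx P \in unitmx by rewrite unitmx_inv.
  have := posdefmx_congr uV pA.
  by rewrite PE trmxCK AE -PE !mulmxA mulmxV // mul1mx -mulmxA mulmxV // mulmx1.
exists (P ^t* *m diag_mx (map_mx sqrtC d) *m P).
  apply: posdefmx_congr => //; apply/posdefmx_diag => i.
  by rewrite mxE sqrtC_gt0.
rewrite AE -PE !mulmxA mulmxK // -!mulmxA; congr (_ *m _).
rewrite mulmxA; congr (_ *m _); apply/matrixP => i j.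
by rewrite mul_diag_mx !mxE; case: eqP => [->|];
  rewrite ?mulr0 // mulr1n -expr2 sqrtCK.
Qed.

(** With [S] the square root of [A], the equation becomes (S G S)^2 = S X S, solved by G = S^-1 (S X
    S)^(1/2) S^-1. *)
Lemma posdefmx_riccati A X : posdefmx A -> posdefmx X ->
  exists2 G, posdefmx G & G *m A *m G = X.
Proof.
move=> /posdefmx_sqrt[S pS <-] pX.
have uS := posdefmx_unit pS; have SE := posdefmx_adj pS.
have := posdefmx_congr uS pX; rewrite SE => /posdefmx_sqrt[D pD DE].
have uV : invmx S \in unitmx by rewrite unitmx_inv.
exists (invmx S *m D *m invmx S).
  by have := posdefmx_congr uV pD; rewrite adjmxV SE.
rewrite !mulmxA mulmxKV // mulmxK // -[_ *m D *m D]mulmxA DE.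
by rewrite !mulmxA mulVmx // mul1mx mulmxK.
Qed.
End PosDef.

(** * Spectrum of Hermitian matrices and a min-max bound *)

Section Eigenvalues.
Variable C : numClosedFieldType.

Lemma char_poly_similar n (P M : 'M[C]_n) : P \in unitmx ->
  char_poly (invmx P *m M *m P) = char_poly M.
Proof.
move=> uP; rewrite /char_poly.
have -> : char_poly_mx (invmx P *m M *m P) =
    map_mx polyC (invmx P) *m char_poly_mx M *m map_mx polyC P.
  rewrite /char_poly_mx mulmxBr mulmxBl !map_mxM; congr (_ - _).
  by rewrite mul_mx_scalar -scalemxAl -map_mxM mulVmx // map_mx1 scalemx1.
by rewrite !det_mulmx mulrAC -det_mulmx -map_mxM mulVmx // map_mx1 det1 mul1r.
Qed.

(** [M] is similar to its spectral diagonal, so both lists split the same monic polynomial into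
    linear factors, which are unique up to order. *)
Lemma eigenvals_spectral n (M : 'M[C]_n) : M \is normalmx ->
  perm_eq (eigenvals M) [seq spectral_diag M 0 i | i <- enum 'I_n].
Proof.
move=> /orthomx_spectralP ME; apply: prod_XsubC_eq.
rewrite /eigenvals; case: closed_field_poly_normal => s /= sE.
rewrite (monicP (char_poly_monic M)) scale1r in sE; rewrite -sE {sE s}.
rewrite {1}ME char_poly_similar ?spectral_unit //.
rewrite char_poly_trig; last first.
  by apply/is_trig_mxP => i j ij; rewrite mxE -val_eqE ltn_eqF.
rewrite big_map big_enum; apply: eq_bigr => i _.
by rewrite mxE eqxx.
Qed.

Lemma exists_mulmx_eq0 k r (N : 'M[C]_(k, r)) : (k < r)%N ->
  exists2 u : 'cV[C]_r, u != 0 & N *m u = 0.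
Proof.
move=> kr; have : kermx N^T != 0.
  rewrite -mxrank_eq0 mxrank_ker mxrank_tr -lt0n subn_gt0.
  exact: leq_ltn_trans (rank_leq_row N) kr.
case/rowV0Pn=> v /sub_kermxP vN v0; exists v^T; first by rewrite trmx_eq0.
by rewrite -[N]trmxK -trmx_mul vN trmx0.
Qed.

(* One half of the Courant-Fischer principle, the r-dimensional subspace being
   the column space of V. *)
Lemma eigval_ge n r (M : 'M[C]_n) (V : 'M[C]_(n, r)) (a : C) :
    (0 < r)%N -> a \is Num.real -> M \is hermsymmx ->
    (forall u : 'cV[C]_r, u != 0 -> V *m u != 0) ->
    (forall u : 'cV[C]_r,
       a * ((V *m u) ^t* *m (V *m u)) 0 0 <= ((V *m u) ^t* *m M *m (V *m u)) 0 0) ->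
  a <= eigval r M.
Proof.
move=> r0 areal hM injV VM; have nM := hermitian_normalmx hM.
set d := spectral_diag M; set P := spectralmx M.
have dreal i : d 0 i \is Num.real.
  by have /mxOverP/(_ 0 i) := hermitian_spectral_diag_real hM.
have eigM := eigenvals_spectral nM.
have eigreal : all [pred x | x \is Num.real] (eigenvals M).
  by rewrite (perm_all _ eigM); apply/allP => _ /mapP[i _ ->] /=.
have sortM : sorted >=%R (sort >=%R (eigenvals M)).
  apply: sort_sorted_in eigreal => x y xR yR.
  by rewrite orbC; apply: real_comparable.
(* The list is increasing for the dual order C^d. *)
apply: (@nth_count_le _ C^d a 0 _ r.-1) sortM _.
(* Positions count from 0, so for index [r.-1] it suffices that at least [r] eigenvalues are at
   least [a]. Suppose there are fewer. *)
rewrite prednK // count_sort (permP eigM) count_map leqNgt; apply/negP => kr.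
set S := [pred i | a <= d 0 i].
have {}kr : (#|S| < r)%N.
  by rewrite cardE /enum_mem size_filter -enumT; apply: leq_ltn_trans kr.
(* Fewer than [r] linear conditions on [u]: [V *m u] can be made orthogonal to every vector of the
   spectral basis whose eigenvalue is at least [a]. *)
have [u u0 Nu0] := exists_mulmx_eq0 (rowsub (@enum_val _ S) (P *m V)) kr.
have uP : P \is unitarymx := spectral_unitarymx M.
set w := P *m (V *m u).
have wS i : a <= d 0 i -> w i 0 = 0.
  move=> Si; have iS : i \in S by [].
  move/matrixP/(_ (enum_rank_in iS i) 0): Nu0.
  by rewrite mul_rowsub_mx -mulmxA -/w [RHS]mxE mxE enum_rankK_in.
have w0 : w != 0.
  apply: contra_neq (injV u u0) => w0.
  by rewrite -[V *m u](mulKmx (unitarymx_unit uP)) -/w w0 mulmx0.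
have := VM u.
have -> : V *m u = P ^t* *m w.
  by rewrite -invmx_unitary // /w mulKmx // unitarymx_unit.
clearbody w.
rewrite adjmxM trmxCK mulmxA mulmxtVK //.
have /orthomx_spectralP -> := nM.
rewrite -/P -/d invmx_unitary // !mulmxA !(mulmxtVK _ uP).
rewrite adjmx_diag_sum adjmx_self_sum mulr_sumr.
(* [w] is supported on the indices with [d 0 i < a], so its form is strictly below [a] times its
   squared norm, contradicting [VM]. *)
rewrite lt_geF //; have /cV0Pn[j wj0] := w0.
have daj : d 0 j < a by rewrite real_ltNge //; apply: contra wj0 => /wS ->.
rewrite (bigD1 j) //= [ltRHS](bigD1 j) //= ltr_leD //.
  by rewrite ltr_pM2r // exprn_gt0 // normr_gt0.
apply: ler_sum => i _.
have [/wS -> | ad] := boolP (a <= d 0 i); first by rewrite normr0 expr0n !mulr0.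
by rewrite ler_wpM2r ?exprn_ge0 // real_leNgt //; apply: contra ad => /ltW.
Qed.
End Eigenvalues.

(** * Completion of squares as noncommutative identities *)

Section Completion.
Variables (K : comNzRingType) (r : nat) (A p G g X Y H : 'M[K]_r).
Hypotheses (Ap : A *m p = 1%:M) (pA : p *m A = 1%:M).
Hypotheses (Gg : G *m g = 1%:M) (gG : g *m G = 1%:M).
Hypotheses (XE : X = G *m A *m G) (YE : Y = g *m p *m g).
Hypothesis HE : H = Y *m Y - A *m A.

Let ApK (W : 'M_r) : A *m (p *m W) = W. Proof. by rewrite mulmxA Ap mul1mx. Qed.
Let pAK (W : 'M_r) : p *m (A *m W) = W. Proof. by rewrite mulmxA pA mul1mx. Qed.
Let GgK (W : 'M_r) : G *m (g *m W) = W. Proof. by rewrite mulmxA Gg mul1mx. Qed.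
Let gGK (W : 'M_r) : g *m (G *m W) = W. Proof. by rewrite mulmxA gG mul1mx. Qed.

(* Reduces to an identity between entries, the words in A, p, G, g that survive
   the cancellations being treated as independent matrices. *)
Ltac expand_mx :=
  rewrite ?(mulmxDl, mulmxDr, mulNmx, mulmxN) -?mulmxA;
  rewrite ?(ApK, pAK, GgK, gGK, Ap, pA, Gg, gG, mul1mx, mulmx1);
  repeat match goal with |- context [?P *m ?Q] => move: (P *m Q) => ? end;
  move: (1%:M) => ?; apply/matrixP => ? ?; rewrite !mxE; ring.

(** Since Y G = g p and G Y = p g, the first square contributes -2 p g p, which the second one
    cancels; moreover p H p = p Y^2 p - 1. *)
Lemma gram_completion :
  (1%:M + G) *m (1%:M + G) + p *m H *m p =
  p *+ 4 + (p *m Y - G) *m (Y *m p - G) + ((p - G) *m g *m (p - G)) *+ 2.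
Proof. rewrite HE YE; expand_mx. Qed.

(** For H = B B^* the left side is V^*MV + 8 p, the 8 p being moved there to avoid a subtraction. As
    V^*V = 4 p + D, the difference 4 V^*V - 8 p is 2 V^*V + 2 D. *)
Lemma form_completion :
  (1%:M + G) *m ((A + X) *m (1%:M + G) + H *m p) +
    p *m H *m (1%:M + G + p *m H *m p) + p *+ 8 =
  ((1%:M + G) *m (1%:M + G) + p *m H *m p) *+ 4 +
  ((G *m A + p *m Y *m Y - 1%:M *+ 2) *m p *m (A *m G + Y *m Y *m p - 1%:M *+ 2) +
   (1%:M + G - G *m Y *+ 2) *m X *m (1%:M + G - Y *m G *+ 2)).
Proof. rewrite HE XE YE !mulr2n; expand_mx. Qed.
End Completion.

(** * The test space spanned by the columns of [V] *)

Section GeometricMean.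
Variables (C : numClosedFieldType) (r m : nat).
Variables (A G : 'M[C]_r) (B : 'M[C]_(r, m)).
Hypotheses (pA : posdefmx A) (pG : posdefmx G).
Let p := invmx A.
Let g := invmx G.
Let X := G *m A *m G.
Let Y := invmx X.
Hypothesis AXB : X *m (A *m A + B *m B ^t*) *m X = 1%:M.

Let M := block_mx (A + X) B (B ^t*) (B ^t* *m p *m B).
(** [M] is the sum of [A; B^*] p [A, B] and [1; 0] X [1, 0], while [V] is [A; B^*] p + [1; 0] G,
    which mixes the ranges of the two summands. *)
Let V := col_mx (1%:M + G) (B ^t* *m p).

Let uA : A \in unitmx := posdefmx_unit pA.
Let uG : G \in unitmx := posdefmx_unit pG.
Let uX : X \in unitmx.
Proof. by rewrite !unitmx_mul uA uG. Qed.

Let YE : Y = g *m p *m g.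
Proof.
apply: (can_inj (mulmxK uX)); rewrite mulVmx // /X -!mulmxA.
by rewrite mulKmx // mulKmx // mulVmx.
Qed.

Let BE : B *m B ^t* = Y *m Y - A *m A.
Proof.
apply: (canRL (addrK _)); rewrite addrC.
apply: (can_inj (mulmxK uX)); apply: (can_inj (mulKmx uX)).
by rewrite mulmxA AXB mulmxKV // mulmxV.
Qed.

Let adjV : V ^t* = row_mx (1%:M + G) (p *m B).
Proof.
rewrite tr_col_mx map_row_mx adjmxD adjmx1 (posdefmx_adj pG) adjmxM trmxCK.
by rewrite adjmxV (posdefmx_adj pA).
Qed.

Let adjp : p ^t* = p. Proof. exact/posdefmx_adj/posdefmx_inv. Qed.
Let adjg : g ^t* = g. Proof. exact/posdefmx_adj/posdefmx_inv. Qed.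
Let adjY : Y ^t* = Y. Proof. by rewrite YE !adjmxM adjp adjg mulmxA. Qed.

Let S1 := Y *m p - G.
Let S2 := p - G.
(** The inner [1%:M] gives the first term the shape N^* P N required by [posdefmx_ge0]. *)
Let D := S1 ^t* *m 1%:M *m S1 + (S2 ^t* *m g *m S2) *+ 2.

Let VVE : V ^t* *m V = (1%:M + G) *m (1%:M + G) + p *m (B *m B ^t*) *m p.
Proof. by rewrite adjV mul_row_col !mulmxA. Qed.

Let gramV : V ^t* *m V = p *+ 4 + D.
Proof.
rewrite VVE (gram_completion (mulmxV uA) (mulVmx uA) (mulmxV uG) (mulVmx uG)
  YE BE).
by rewrite /D /S1 /S2 !adjmxD !adjmxN !adjmxM adjp adjY (posdefmx_adj pG) mulmx1
  [RHS]addrA.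
Qed.

Let T1 := A *m G + Y *m Y *m p - 1%:M *+ 2.
Let T2 := 1%:M + G - Y *m G *+ 2.

Let formV : V ^t* *m M *m V =
  (V ^t* *m V) *+ 2 + D *+ 2 + (T1 ^t* *m p *m T1 + T2 ^t* *m X *m T2).
Proof.
have VMVE : V ^t* *m M *m V =
    (1%:M + G) *m ((A + X) *m (1%:M + G) + B *m B ^t* *m p) +
    p *m (B *m B ^t*) *m (1%:M + G + p *m (B *m B ^t*) *m p).
  by rewrite -mulmxA mul_block_col adjV mul_row_col -!mulmxA
    -(mulmxDr (B ^t*)).
apply: (addIr (p *+ 8)); rewrite VMVE.
rewrite (form_completion (mulmxV uA) (mulVmx uA) (mulmxV uG) (mulVmx uG)
  (erefl X) YE BE) -VVE.
have -> : G *m A + p *m Y *m Y - 1%:M *+ 2 = T1 ^t*.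
  rewrite /T1 !adjmxD adjmxN !mulr2n !adjmxD adjmx1 !adjmxM adjp adjY.
  by rewrite (posdefmx_adj pG) (posdefmx_adj pA) mulmxA.
have -> : 1%:M + G - G *m Y *+ 2 = T2 ^t*.
  rewrite /T2 !adjmxD adjmxN !mulr2n !adjmxD adjmx1 !adjmxM adjY.
  by rewrite (posdefmx_adj pG).
(* With V^*V = 4 p + D, both sides equal 16 p + 4 D + T, where [T] is the sum of the last two
   squares. *)
rewrite gramV; move: (_ + T2 ^t* *m X *m T2) D => T D'.
by apply/matrixP => i j; rewrite !mxE; ring.
Qed.

Let qD (u : 'cV[C]_r) (P Q : 'M[C]_r) :
  (u ^t* *m (P + Q) *m u) 0 0 = (u ^t* *m P *m u) 0 0 + (u ^t* *m Q *m u) 0 0.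
Proof. by rewrite mulmxDr mulmxDl [LHS]mxE. Qed.

Let qMn (u : 'cV[C]_r) (P : 'M[C]_r) k :
  (u ^t* *m (P *+ k) *m u) 0 0 = (u ^t* *m P *m u) 0 0 *+ k.
Proof.
elim: k => [|k IH]; last by rewrite !mulrS qD IH.
by rewrite !mulr0n mulmx0 mul0mx mxE.
Qed.

Lemma ritz_compression_ge2 (u : 'cV[C]_r) :
  2 * ((V *m u) ^t* *m (V *m u)) 0 0 <= ((V *m u) ^t* *m M *m (V *m u)) 0 0.
Proof.
have pX : posdefmx X by have := posdefmx_congr uG pA; rewrite posdefmx_adj.
have pp := posdefmx_inv pA; have pg := posdefmx_inv pG.
have -> : (V *m u) ^t* *m M *m (V *m u) = u ^t* *m (V ^t* *m M *m V) *m u.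
  by rewrite adjmxM !mulmxA.
have -> : (V *m u) ^t* *m (V *m u) = u ^t* *m (V ^t* *m V) *m u.
  by rewrite adjmxM !mulmxA.
rewrite formV !qD mulr_natl mulr2n -addrA lerDl.
by rewrite !(qD, addr_ge0) // posdefmx_ge0 //; apply: posdefmx1.
Qed.

(** V^*V exceeds the positive definite matrix 4 p by [D], whose form is nonnegative. *)
Lemma ritz_basis_inj (u : 'cV[C]_r) : u != 0 -> V *m u != 0.
Proof.
move=> u0; have pp := posdefmx_inv pA; have pg := posdefmx_inv pG.
suff : 0 < ((V *m u) ^t* *m (V *m u)) 0 0.
  by apply: contraTneq => ->; rewrite mulmx0 mxE ltxx.
have -> : (V *m u) ^t* *m (V *m u) = u ^t* *m (V ^t* *m V) *m u.
  by rewrite adjmxM !mulmxA.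
rewrite gramV qD ltr_wpDr //; last by rewrite qMn pmulrn_lgt0 // pp.2.
by rewrite !(qD, addr_ge0) // posdefmx_ge0 //; apply: posdefmx1.
Qed.
End GeometricMean.

Theorem proposition2p1 (R : realType) (n r : nat)
    (hr1 : (1 <= r)%N) (hrn : (r <= n)%N)
    (A11 X : 'M[R[i]]_r) (A12 : 'M[R[i]]_(r, n - r))
    (hA11 : posdefmx A11) (hX : posdefmx X)
    (hAX : X *m (A11 *m A11 + A12 *m A12 ^t*) *m X = 1%:M) :
  let M : 'M[R[i]]_(r + (n - r)) :=
    block_mx (A11 + X)  A12
             (A12 ^t*)  (A12 ^t* *m invmx A11 *m A12) in
  M \is hermsymmx /\ 2 <= eigval r M.
Proof.
move=> M; have hM : M \is hermsymmx.
  apply/hermsymmxP; rewrite /M tr_block_mx map_block_mx adjmxD !adjmxM trmxCK.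
  by rewrite adjmxV (posdefmx_adj hA11) (posdefmx_adj hX) mulmxA.
split=> //; have [G pG GE] := posdefmx_riccati hA11 hX.
(* Writing [X] as G A11 G makes [G] the primary datum, as in the lemmas on [V]. *)
rewrite /M -GE in hAX hM *.
apply: (@eigval_ge _ _ _ _ (col_mx (1%:M + G) (A12 ^t* *m invmx A11))) => //.
- exact: ritz_basis_inj.
- exact: ritz_compression_ge2.
Qed.
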